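(* Let $f=\frac1n\sum_{i=1}^n f_i$ where each $f_i:\mathbb{R}^d\to\mathbb{R}$ is differentiable, lower bounded, convex and $L_i$-smooth ($L_i>0$), and set $L_{\max}=\max_{i\in[n]}L_i$. Suppose $f$ has a minimizer; let $x^*$ be one and $f^*=f(x^* )$. Let $0\le\rho\le\frac{1}{L_{\max}}$, let $\gamma_b>0$, and let $\alpha=(1-L_{\max}\rho)^2\min\left\{\frac{1}{2L_{\max}},\gamma_b\right\}$. Let $(x^t)_{t\ge0}$ be the iterates of stochastic USAM with constant radius $\rho_t=\rho$ and the Stochastic Polyak Scheduler with cap $\gamma_b$ (defined in the context), started at $x^0\in\mathbb{R}^d$. Then for all $T\ge1$, $$\mathbb{E}[f(\overline{x}^T)-f^*]\le\frac{\|x^0-x^*\|^2}{\alpha\,T}+\frac{2\gamma_b-\alpha}{\alpha}\,\sigma^2,$$ where $\overline{x}^T=\frac1T\sum_{t=0}^{T-1}x^t$ and $\sigma^2=\mathbb{E}_{S_t}\left[f_{S_t}(x^* )-\ell_{S_t}^*\right]$.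
   Context: $\|\cdot\|$ is the Euclidean norm; $g$ is $L$-smooth if $\|\nabla g(x)-\nabla g(y)\|\le L\|x-y\|$ for all $x,y$. Fix a mini-batch size $\tau\in\{1,\dots,n\}$. The mini-batches $S_0,S_1,\dots$ are i.i.d., each uniformly distributed over the subsets of $[n]=\{1,\dots,n\}$ of size $\tau$. For $S\subseteq[n]$ with $|S|=\tau$, $f_S=\frac1\tau\sum_{i\in S}f_i$, and $\ell_S^*\in\mathbb{R}$ is a given (deterministic) lower bound of $f_S$, i.e. $\ell_S^*\le f_S(x)$ for all $x$. Stochastic USAM with constant radius $\rho$ and the Stochastic Polyak Scheduler with cap $\gamma_b$: for $t\ge0$, $$e^t=x^t+\rho\nabla f_{S_t}(x^t),\quad \gamma_t=\min\left\{\frac{f_{S_t}(e^t)-\ell_{S_t}^*-\rho\langle\nabla f_{S_t}(e^t),\nabla f_{S_t}(x^t)\rangle}{\|\nabla f_{S_t}(e^t)\|^2},\gamma_b\right\},\quad x^{t+1}=x^t-\gamma_t\nabla f_{S_t}(e^t).$$ Conventions: if $\nabla f_{S_t}(e^t)=0$ the quotient is read as $+\infty$, so $\gamma_t=\gamma_b$ and $x^{t+1}=x^t$. If $\alpha=0$ (i.e. $\rho=1/L_{\max}$) the right-hand side of the bound is read as $+\infty$. Expectation is over $S_0,S_1,\dots$. *)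

(* Defs.v *)
From HB Require Import structures.
From mathcomp Require Import all_boot all_order all_algebra.
From mathcomp Require Import all_classical all_reals all_analysis.

Set Implicit Arguments.
Unset Strict Implicit.
Unset Printing Implicit Defensive.
Import Order.TTheory GRing.Theory Num.Theory.
Import numFieldNormedType.Exports.
Local Open Scope classical_set_scope.
Local Open Scope ring_scope.

(* The library's norm on ['rV[R]_d] is the sup norm, so the Euclidean structure
   of R^d is defined here.  The topology is the same, hence so are
   [differentiable] and ['D_v]. *)
Definition dotp (R : realType) (d : nat) (u v : 'rV[R]_d) : R :=
  \sum_(j < d) u 0 j * v 0 j.

Definition enorm (R : realType) (d : nat) (u : 'rV[R]_d) : R :=
  Num.sqrt (dotp u u).

Definition grad (R : realType) (d : nat) (g : 'rV[R]_d -> R) (x : 'rV[R]_d)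
    : 'rV[R]_d :=
  \row_(j < d) 'D_(delta_mx 0 j) g x.

Definition smooth (R : realType) (d : nat) (L : R) (g : 'rV[R]_d -> R) : Prop :=
  forall x y, enorm (grad g x - grad g y) <= L * enorm (x - y).

Definition favg (R : realType) (d n : nat) (f : 'I_n -> 'rV[R]_d -> R)
    (x : 'rV[R]_d) : R :=
  n%:R^-1 * \sum_(i < n) f i x.

Definition fbatch (R : realType) (d n : nat) (f : 'I_n -> 'rV[R]_d -> R)
    (tau : nat) (A : {set 'I_n}) (x : 'rV[R]_d) : R :=
  tau%:R^-1 * \sum_(i in A) f i x.

(* The default value 0 of the maximum is harmless for positive [L i], 0 < n. *)
Definition Lmax (R : realType) (n : nat) (L : 'I_n -> R) : R :=
  \big[Num.max/0]_(i < n) L i.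

Section usam.
Context (R : realType) (d n : nat) (f : 'I_n -> 'rV[R]_d -> R) (tau : nat).
Context (ell : {set 'I_n} -> R) (rho gamma_b : R).
Implicit Types (A : {set 'I_n}) (x : 'rV[R]_d).

Definition usam_ascent A x : 'rV[R]_d := x + rho *: grad (fbatch f tau A) x.

Definition polyak_step A x : R :=
  let e := usam_ascent A x in
  let ge := grad (fbatch f tau A) e in
  if ge == 0 then gamma_b
  else Num.min ((fbatch f tau A e - ell A
                 - rho * dotp ge (grad (fbatch f tau A) x)) / enorm ge ^+ 2)
               gamma_b.

Definition usam_step A x : 'rV[R]_d :=
  x - polyak_step A x *: grad (fbatch f tau A) (usam_ascent A x).

Fixpoint usam_iter (x0 : 'rV[R]_d) (S : nat -> {set 'I_n}) (t : nat)
    : 'rV[R]_d :=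
  if t is t'.+1 then usam_step (S t') (usam_iter x0 S t') else x0.

Definition usam_mean (x0 : 'rV[R]_d) (S : nat -> {set 'I_n}) (T : nat)
    : 'rV[R]_d :=
  T%:R^-1 *: \sum_(t < T) usam_iter x0 S t.

End usam.

(* Random elements of a finite type, which carries its full powerset as
   sigma-algebra: every [A : set U] is an event. *)
Definition mutually_independent (R : realType) (disp : measure_display)
    (Omega : measurableType disp) (P : probability Omega R) (U : finType)
    (X : nat -> Omega -> U) : Prop :=
  forall (I : seq nat) (A : nat -> set U), uniq I ->
    P (\bigcap_(i in [set` I]) (X i @^-1` A i))
    = (\prod_(i <- I) P (X i @^-1` A i))%E.

Definition iid_minibatches (R : realType) (disp : measure_display)
    (Omega : measurableType disp) (P : probability Omega R) (n tau : nat)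
    (S : nat -> Omega -> {set 'I_n}) : Prop :=
  [/\ forall t (A : set {set 'I_n}), measurable (S t @^-1` A),
      mutually_independent P S
    & forall t (A : {set 'I_n}),
        P (S t @^-1` [set A])
        = (if #|A| == tau then 'C(n, tau)%:R^-1 else 0)%:E].

Definition usam_alpha (R : realType) (Lm rho gamma_b : R) : R :=
  (1 - Lm * rho) ^+ 2 * Num.min (2 * Lm)^-1 gamma_b.

Definition sigma2 (R : realType) (disp : measure_display)
    (Omega : measurableType disp) (P : probability Omega R) (d n : nat)
    (f : 'I_n -> 'rV[R]_d -> R) (tau : nat) (ell : {set 'I_n} -> R)
    (xstar : 'rV[R]_d) (St : Omega -> {set 'I_n}) : \bar R :=
  'E_P[fun w => fbatch f tau (St w) xstar - ell (St w)].

(* Main.v *)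
(* For a batch function g with gradients u at x and w at e = x + rho u, write
   N = g(e) - ell - rho <w, u>.  Convexity at e gives <w, x - x*> >= N - (g(x* )
   - ell), so expanding the square and using gamma |w|^2 <= N,
     |x+ - x*|^2 <= |x - x*|^2 - gamma N + 2 gamma_b (g(x* ) - ell).
   Co-coercivity yields N >= (1 - (L rho)^2) (g(x) - ell) and
   |w| <= (1 + L rho) |u|, while |u|^2 <= 2 L (g(x) - ell); hence
   gamma N >= alpha (g(x) - ell) in both branches of the minimum.  Averaging
   over the batch, summing over the steps and applying Jensen's inequality to f
   gives the bound. *)
Require Import Defs.
From HB Require Import structures.
From mathcomp Require Import all_boot all_order all_algebra.
From mathcomp Require Import all_classical all_reals all_analysis.
From mathcomp Require Import ring lra.

Set Implicit Arguments.
Unset Strict Implicit.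
Unset Printing Implicit Defensive.
Import Order.TTheory GRing.Theory Num.Theory.
Import numFieldNormedType.Exports.
Local Open Scope classical_set_scope.
Local Open Scope ring_scope.

(** * Euclidean inner product and the Cauchy-Schwarz inequality *)

Section dot_product.
Context (R : realType) (d : nat).
Implicit Types (u v w : 'rV[R]_d) (a : R).

Lemma dotpC u v : dotp u v = dotp v u.
Proof. by apply: eq_bigr => j _; rewrite mulrC. Qed.

Lemma dotpDl u v w : dotp (u + v) w = dotp u w + dotp v w.
Proof. by rewrite -big_split; apply: eq_bigr => j _; rewrite mxE mulrDl. Qed.

Lemma dotpZl a u w : dotp (a *: u) w = a * dotp u w.
Proof. by rewrite mulr_sumr; apply: eq_bigr => j _; rewrite mxE mulrA. Qed.

Lemma dotpNl u w : dotp (- u) w = - dotp u w.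
Proof. by rewrite -scaleN1r dotpZl mulN1r. Qed.

Lemma dotp0l w : dotp 0 w = 0.
Proof. by rewrite -(scale0r 0) dotpZl mul0r. Qed.

Lemma dotp_suml (I : Type) (r : seq I) (Q : pred I) (F : I -> 'rV[R]_d) w :
  dotp (\sum_(i <- r | Q i) F i) w = \sum_(i <- r | Q i) dotp (F i) w.
Proof.
by apply: (big_morph (fun u => dotp u w)) => [u v|]; rewrite (dotpDl, dotp0l).
Qed.

Lemma dotpDr u v w : dotp w (u + v) = dotp w u + dotp w v.
Proof. by rewrite ![dotp w _]dotpC dotpDl. Qed.

Lemma dotpZr a u w : dotp w (a *: u) = a * dotp w u.
Proof. by rewrite ![dotp w _]dotpC dotpZl. Qed.

Lemma dotpNr u w : dotp w (- u) = - dotp w u.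
Proof. by rewrite ![dotp w _]dotpC dotpNl. Qed.

Lemma dotp_sumr (I : Type) (r : seq I) (Q : pred I) (F : I -> 'rV[R]_d) w :
  dotp w (\sum_(i <- r | Q i) F i) = \sum_(i <- r | Q i) dotp w (F i).
Proof. by rewrite dotpC dotp_suml; apply: eq_bigr => i _; rewrite dotpC. Qed.

Lemma dotp_ge0 u : 0 <= dotp u u.
Proof. by apply: sumr_ge0 => j _; rewrite -expr2 sqr_ge0. Qed.

Lemma dotp_eq0 u : (dotp u u == 0) = (u == 0).
Proof.
apply/eqP/eqP => [|->]; last exact: dotp0l.
move/eqP; rewrite psumr_eq0 => [/allP u0|j _]; last by rewrite -expr2 sqr_ge0.
apply/rowP => j; have := u0 j (mem_index_enum _).
by rewrite -expr2 sqrf_eq0 mxE => /eqP.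
Qed.

Lemma enorm_sqr u : enorm u ^+ 2 = dotp u u.
Proof. by rewrite sqr_sqrtr ?dotp_ge0. Qed.

Lemma enorm_ge0 u : 0 <= enorm u.
Proof. exact: sqrtr_ge0. Qed.

(** For [v] nonzero, the squared norm of [dotp v v *: u - dotp u v *: v] is [dotp v v] times the gap
    between the squares of the two sides. *)
Lemma dotp_le_enorm u v : dotp u v <= enorm u * enorm v.
Proof.
have [v0|v_neq0] := eqVneq v 0.
  by rewrite v0 dotpC dotp0l mulr_ge0 // enorm_ge0.
have v_gt0 : 0 < dotp v v by rewrite lt_def dotp_eq0 v_neq0 dotp_ge0.
apply: le_trans (ler_norm _) _.
rewrite -(@ler_pXn2r _ 2) ?nnegrE ?mulr_ge0 ?enorm_ge0 //.
rewrite exprMn !enorm_sqr real_normK ?num_real //.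
have := dotp_ge0 (dotp v v *: u - dotp u v *: v).
rewrite !(dotpDl, dotpDr, dotpZl, dotpZr, dotpNl, dotpNr) (dotpC v u).
move=> h; rewrite -subr_ge0 -(pmulr_rge0 _ v_gt0).
by apply: le_trans h _; rewrite le_eqVlt; apply/orP; left; apply/eqP; ring.
Qed.

Lemma enormZ a u : 0 <= a -> enorm (a *: u) = a * enorm u.
Proof.
move=> a0; rewrite /enorm dotpZl dotpZr mulrA -expr2 sqrtrM ?sqr_ge0 //.
by rewrite sqrtr_sqr ger0_norm.
Qed.

End dot_product.

(** * Gradients and first-order inequalities along segments *)

Section differential_calculus.
Context (R : realType) (d : nat).
Implicit Types (g : 'rV[R]_d -> R) (x y v : 'rV[R]_d).

(** [grad] records only partial derivatives; linearity of the differential gives every other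
    direction. *)
Lemma derive_grad g x v : differentiable g x -> 'D_v g x = dotp (grad g x) v.
Proof.
move=> dg; rewrite deriveE // [v in LHS]row_sum_delta linear_sum.
by apply: eq_bigr => j _; rewrite linearZ mxE deriveE //= mulrC.
Qed.

Lemma is_derive_line g x v (t : R) : (forall z, differentiable g z) ->
  is_derive t 1 (fun s : R => g (x + s *: v)) (dotp (grad g (x + t *: v)) v).
Proof.
move=> dg.
(* The quotient in the line parameter at [t] is the quotient of [g] at [x + t *: v] in direction
   [v]. *)
have E : (fun h : R => h^-1 *: (((fun s : R => g (x + s *: v)) \o shift t)
            (h *: 1) - g (x + t *: v)))
       = (fun h : R => h^-1 *: ((g \o shift (x + t *: v)) (h *: v)
            - g (x + t *: v))).
  apply/funext => h /=; congr (_ *: (g _ - _)).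
  by rewrite [_ *: 1]mulr1 scalerDl addrCA.
apply: DeriveDef; last by rewrite /derive E -derive_grad.
by rewrite /derivable E; apply: diff_derivable.
Qed.

(** By convexity the difference quotients of [g] at [x] towards [y], with step [h] in []0, 1]], are
    at most [g y - g x]; the bound passes to the limit from the right. *)
Lemma convex_grad_le g x y : (forall z, differentiable g z) ->
  @convex_function R 'rV[R]_d setT g ->
  g x + dotp (grad g x) (y - x) <= g y.
Proof.
move=> dg cg; rewrite -lerBrDl -derive_grad //.
have /cvg_dnbhs_at_right : (fun h : R => h^-1 *: ((g \o shift x) (h *: (y - x))
    - g x)) @ 0^' --> 'D_(y - x) g x by apply: diff_derivable.
move=> /cvgr_to_le; apply; near=> h.
have h0 : 0 < h by near: h; exact: nbhs_right_gt.
have h1 : h <= 1 by near: h; exact: nbhs_right_le.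
have := cg (Itv01 (ltW h0) h1) y x; rewrite !inE => /(_ I I).
have -> : (g \o shift x) (h *: (y - x)) = g (h *: y + (1 - h) *: x).
  by rewrite /= scalerBr scalerBl scale1r addrAC addrA.
rewrite [X in _ <= X]convRE /conv /= => le_conv.
rewrite /GRing.scale /= ler_pdivrMl //.
by have := le_conv; rewrite /unstable.onem; lra.
Unshelve. all: by end_near. Qed.

Lemma descent_le g (L : R) x y : (forall z, differentiable g z) ->
  smooth L g ->
  g y <= g x + dotp (grad g x) (y - x) + L / 2 * dotp (y - x) (y - x).
Proof.
move=> dg sg; set v := y - x.
(* Subtract from [g] on the segment the non-constant part of its quadratic model; by the mean value
   theorem, [dk c <= 0] then gives [k 1 <= k 0], which is the claim. *)
pose k (t : R) := g (x + t *: v) - (t * dotp (grad g x) v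
                   + t ^+ 2 * (L / 2 * dotp v v)).
pose dk (t : R) := dotp (grad g (x + t *: v)) v - (dotp (grad g x) v
                   + t * (L * dotp v v)).
have kd (t : R) : is_derive t 1 k (dk t).
  have ? := is_derive_line x v t dg.
  apply: is_derive_eq; congr (_ - _); rewrite /GRing.scale /=.
  by field.
have [c] : exists2 c, c \in `[0, 1] & k 1 - k 0 = dk c * (1 - 0).
  apply: MVT_segment => //.
  apply: derivable_within_continuous => t _.
  exact: (@ex_derive _ _ _ _ _ _ _ (kd t)).
rewrite in_itv /= => /andP[c0 c1] kE.
(* Cauchy-Schwarz and the Lipschitz bound at distance [c * enorm v] from [x] match the term
   [c * (L * dotp v v)]. *)
have dkc : dk c <= 0.
  rewrite /dk -{1}(subrK (grad g x) (grad g (x + c *: v))) dotpDl.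
  have := dotp_le_enorm (grad g (x + c *: v) - grad g x) v.
  have := sg (x + c *: v) x; rewrite addrAC subrr add0r enormZ // => gL.
  have := ler_wpM2r (enorm_ge0 v) gL; rewrite -(enorm_sqr v).
  by lra.
move: kE; rewrite subr0 mulr1 /k scale1r scale0r addr0 (addrC x) subrK.
by lra.
Qed.

End differential_calculus.

(** * One step of the method on a single smooth convex function *)

Section smooth_convex.
Context (R : realType) (d : nat) (g : 'rV[R]_d -> R) (L m : R).
Hypothesis L_gt0 : 0 < L.
Hypothesis g_convex : forall x y, g x + dotp (grad g x) (y - x) <= g y.
Hypothesis g_descent : forall x y,
  g y <= g x + dotp (grad g x) (y - x) + L / 2 * dotp (y - x) (y - x).
Hypothesis g_lb : forall x, m <= g x.

(* Compare the upper model of g at y with the lower model at x in the point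
   y - L^-1 (g'(y) - g'(x)). *)
Lemma cocoercive_le x y :
  g x + dotp (grad g x) (y - x)
    + (2 * L)^-1 * dotp (grad g y - grad g x) (grad g y - grad g x) <= g y.
Proof.
set D := grad g y - grad g x.
have DE : dotp D D = dotp (grad g y) D - dotp (grad g x) D.
  by rewrite {1}/D dotpDl dotpNl.
clearbody D; have := le_trans (g_convex x _) (g_descent y (y - L^-1 *: D)).
rewrite [in dotp (grad g x) _]addrAC [y - _ - y]addrAC subrr add0r.
rewrite !(dotpDr, dotpNr, dotpNl, dotpZr, dotpZl).
have -> : L / 2 * - - (L^-1 * (L^-1 * dotp D D)) = (2 * L)^-1 * dotp D D.
  by field; rewrite gt_eqF.
have LE : (2 * L)^-1 * dotp D D + (2 * L)^-1 * dotp D D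
    = L^-1 * dotp (grad g y) D - L^-1 * dotp (grad g x) D.
  by rewrite -mulrBr -DE; field; rewrite gt_eqF.
by lra.
Qed.

(** The step from [x] by [- L^-1 *: grad g x] lowers the quadratic model by [(2 * L)^-1] times the
    squared gradient norm, while [g] stays above [m] there. *)
Lemma grad_sqr_le x : dotp (grad g x) (grad g x) <= 2 * L * (g x - m).
Proof.
have := le_trans (g_lb _) (g_descent x (x - L^-1 *: grad g x)).
rewrite [x - _ - x]addrAC subrr add0r.
rewrite !(dotpNr, dotpNl, dotpZr, dotpZl).
set q := dotp _ _ => h.
have LE : q = 2 * L * (L^-1 * q - L / 2 * - - (L^-1 * (L^-1 * q))).
  by field; rewrite gt_eqF.
by rewrite LE ler_pM2l ?mulr_gt0 //; lra.
Qed.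

Variable rho : R.
Hypothesis rho_ge0 : 0 <= rho.
Hypothesis Lrho_le1 : L * rho <= 1.

(** Let [D = ge - gx] and [a = L * rho]. Co-coercivity in both directions adds up to [DD <= a * Dg];
    with [D - a *: gx] of nonnegative squared norm this gives [Dg <= a * gg], and both bounds enter
    the expansion of the squared norm of [D + gx]. *)
Lemma ascent_grad_sqr_le x (ge := grad g (x + rho *: grad g x)) :
  dotp ge ge <= (1 + L * rho) ^+ 2 * dotp (grad g x) (grad g x).
Proof.
set gx := grad g x; set e := x + rho *: gx.
have := cocoercive_le x e; have := cocoercive_le e x.
rewrite -/ge -/gx -[gx - ge]opprB -[x - e]opprB.
have -> : e - x = rho *: gx by rewrite /e addrAC subrr add0r.
have : ge = (ge - gx) + gx by rewrite subrK.
move: (ge - gx) => D geE; rewrite {}geE.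
have := dotp_ge0 (D - (L * rho) *: gx).
rewrite !(dotpDl, dotpDr, dotpNr, dotpNl, dotpZr, dotpZl) (dotpC gx D).
set DD := dotp D D; set Dg := dotp D gx; set gg := dotp gx gx.
move=> sq_ge0 h1 h2.
have DD_le : DD <= L * rho * Dg.
  have -> : DD = L * ((2 * L)^-1 * DD + (2 * L)^-1 * DD).
    by field; rewrite gt_eqF.
  by rewrite -mulrA ler_pM2l //; lra.
(* The bound on [Dg] divides by [L * rho], so [rho = 0] is treated apart; there [D = 0]. *)
have rho_a : rho = 0 \/ 0 < L * rho.
  have [->|r0] := eqVneq rho 0; [by left | right].
  by rewrite mulr_gt0 // lt_def r0.
case: rho_a DD_le sq_ge0 => [->|a0].
  rewrite !mulr0 !mul0r => D0 _.
  have : DD = 0 by apply/eqP; rewrite eq_le D0 dotp_ge0.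
  move/eqP; rewrite dotp_eq0 => /eqP D_eq0.
  by rewrite /DD /Dg D_eq0 !dotp0l; lra.
move: (L * rho) a0 => a a0 DD_le sq_ge0.
have Dg_le : Dg <= a * gg by rewrite -(ler_pM2l a0); lra.
have : a * Dg <= a * (a * gg) by rewrite ler_pM2l.
by lra.
Qed.

(** Co-coercivity from [x] to [e] leaves [(2 * L)^-1 * DD - rho * Dg] to be bounded below.
    Completing the square costs [(2 * L)^-1 * ((L * rho) ^+ 2 * gg)], which [grad_sqr_le]
    controls. *)
Lemma polyak_gap_ge x (ge := grad g (x + rho *: grad g x)) :
  (1 - (L * rho) ^+ 2) * (g x - m)
    <= g (x + rho *: grad g x) - m - rho * dotp ge (grad g x).
Proof.
set gx := grad g x; set e := x + rho *: gx.
have := cocoercive_le x e; rewrite -/ge -/gx.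
have -> : e - x = rho *: gx by rewrite /e addrAC subrr add0r.
have : ge = (ge - gx) + gx by rewrite subrK.
move: (ge - gx) => D geE; rewrite {}geE.
have := grad_sqr_le x; rewrite -/gx.
have := dotp_ge0 (D - (L * rho) *: gx).
rewrite !(dotpDl, dotpDr, dotpNr, dotpNl, dotpZr, dotpZl) (dotpC gx D).
set DD := dotp D D; set Dg := dotp D gx; set gg := dotp gx gx.
move=> sq_ge0 gg_le h.
have : (2 * L)^-1 * (DD - 2 * (L * rho) * Dg + (L * rho) ^+ 2 * gg) >= 0.
  by rewrite mulr_ge0 ?invr_ge0 ?mulr_ge0 ?(ltW L_gt0) //; lra.
have : (2 * L)^-1 * ((L * rho) ^+ 2 * gg) <= (L * rho) ^+ 2 * (g x - m).
  rewrite mulrCA ler_wpM2l ?sqr_ge0 // mulrC ler_pdivrMr ?mulr_gt0 //.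
  by rewrite mulrC.
have -> : (2 * L)^-1 * (DD - 2 * (L * rho) * Dg + (L * rho) ^+ 2 * gg)
  = (2 * L)^-1 * DD - rho * Dg + (2 * L)^-1 * ((L * rho) ^+ 2 * gg).
  by field; rewrite gt_eqF.
by lra.
Qed.

Variable gamma_b : R.
Hypothesis gamma_b_gt0 : 0 < gamma_b.

(** The let-bound arguments copy [usam_ascent] and [polyak_step], with a lower bound [m] of [g] in
    place of [ell A]. *)
Lemma polyak_descent x y (e := x + rho *: grad g x) (ge := grad g e)
    (N := g e - m - rho * dotp ge (grad g x))
    (gamma := if ge == 0 then gamma_b
              else Num.min (N / enorm ge ^+ 2) gamma_b) :
  enorm (x - gamma *: ge - y) ^+ 2
    <= enorm (x - y) ^+ 2 - usam_alpha L rho gamma_b * (g x - m)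
       + 2 * gamma_b * (g y - m).
Proof.
have N_ge : (1 - (L * rho) ^+ 2) * (g x - m) <= N by exact: polyak_gap_ge.
have ge_le := ascent_grad_sqr_le x; rewrite -/e -/ge in ge_le.
have gx_le := grad_sqr_le x.
have a_ge0 : 0 <= L * rho by rewrite mulr_ge0 // ltW.
have H_ge0 : 0 <= g x - m by rewrite subr_ge0.
have a2_ge0 : 0 <= 1 - (L * rho) ^+ 2 by rewrite subr_ge0 expr_le1.
have N_ge0 : 0 <= N by apply: le_trans N_ge; exact: mulr_ge0.
(* Serves both cases with [gamma = gamma_b]; for [a = L * rho] in [[0, 1]],
   [(1 - a) ^+ 2 <= 1 - a ^+ 2]. *)
have alpha_le : usam_alpha L rho gamma_b * (g x - m) <= gamma_b * N.
  rewrite /usam_alpha.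
  apply: (@le_trans _ _ (gamma_b * ((1 - (L * rho) ^+ 2) * (g x - m)))).
    rewrite mulrA ler_wpM2r // mulrC ler_pM ?sqr_ge0 //.
    - by rewrite le_min (ltW gamma_b_gt0) invr_ge0 mulr_ge0 // ltW.
    - by rewrite ge_min lexx orbT.
    - by nra.
  by rewrite ler_wpM2l // ltW.
(* These four facts are all that the final estimate uses about the step size. *)
have gammaP : [/\ 0 <= gamma, gamma <= gamma_b, gamma * dotp ge ge <= N
    & usam_alpha L rho gamma_b * (g x - m) <= gamma * N].
  rewrite /gamma enorm_sqr; case: eqVneq => [ge0|ge_neq0].
    by rewrite [in dotp _ _]ge0 dotp0l mulr0; split=> //; exact: ltW.
  have q_gt0 : 0 < dotp ge ge by rewrite lt_def dotp_eq0 ge_neq0 dotp_ge0.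
  case: (leP (N / dotp ge ge) gamma_b) => [h|/ltW h].
    split=> //; rewrite ?divr_ge0 ?(ltW q_gt0) ?divfK ?gt_eqF //.
    rewrite [X in _ <= X]mulrAC ler_pdivlMr // /usam_alpha.
    have min_le : Num.min (2 * L)^-1 gamma_b <= (2 * L)^-1.
      by rewrite ge_min lexx.
    have min_ge0 : 0 <= Num.min (2 * L)^-1 gamma_b.
      by rewrite le_min (ltW gamma_b_gt0) invr_ge0 mulr_ge0 // ltW.
    (* Here [gamma * N] is [N ^+ 2 / dotp ge ge]. The bound on [dotp ge ge] brings a factor [2 * L]
       that cancels [(2 * L)^-1], leaving the square of the lower bound on [N]. *)
    apply: (@le_trans _ _ ((1 - L * rho) ^+ 2 * (2 * L)^-1 * (g x - m)
              * ((1 + L * rho) ^+ 2 * (2 * L * (g x - m))))).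
      apply: ler_pM; rewrite ?(ltW q_gt0) ?mulr_ge0 ?subr_ge0 //.
        by rewrite ler_wpM2r // ler_wpM2l ?sqr_ge0.
      by apply: le_trans ge_le _; rewrite ler_wpM2l ?sqr_ge0.
    have -> : (1 - L * rho) ^+ 2 * (2 * L)^-1 * (g x - m)
              * ((1 + L * rho) ^+ 2 * (2 * L * (g x - m)))
            = ((1 - (L * rho) ^+ 2) * (g x - m)) ^+ 2.
      by field; rewrite gt_eqF.
    by rewrite -expr2 ler_pXn2r ?nnegrE ?mulr_ge0.
  split=> //; first exact: ltW.
  by rewrite -ler_pdivlMr.
have : g e + dotp ge (y - e) <= g y by exact: g_convex.
rewrite !enorm_sqr.
have -> : x - gamma *: ge - y = (x - y) - gamma *: ge by rewrite addrAC.
have -> : y - e = - (x - y) - rho *: grad g x.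
  by rewrite opprB /e opprD addrA.
have gm_ge0 : 0 <= g y - m by rewrite subr_ge0.
move: gammaP; rewrite /N; move: gamma => c [c0 cb cge cN].
rewrite !(dotpDl, dotpDr, dotpNr, dotpNl, dotpZr, dotpZl).
rewrite !(dotpC ge).
set dx := dotp x ge; set dy := dotp y ge; set dg := dotp (grad g x) ge.
move: cge cN; rewrite /N (dotpC ge) -/dg => cge cN cvx.
(* Once these bounds are scaled by [c] or, for the noise, by [g y - m], the expanded square follows
   linearly. *)
have : c * (c * dotp ge ge) <= c * (g e - m - rho * dg) by rewrite ler_wpM2l.
have : c * (g y - m) <= gamma_b * (g y - m) by rewrite ler_wpM2r.
have : c * (g e + (- (dx - dy) - rho * dg)) <= c * g y.
  by rewrite ler_wpM2l //; lra.
by lra.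
Qed.

End smooth_convex.

(** * Passing from the components to batch averages, the full average being one of them *)

Lemma favgE (R : realType) (d n : nat) (f : 'I_n -> 'rV[R]_d -> R) x :
  favg f x = fbatch f n [set: 'I_n] x.
Proof.
by rewrite /favg /fbatch; congr (_ * _); apply: eq_bigl => i; rewrite inE.
Qed.

Section minibatch.
Context (R : realType) (d n tau : nat) (f : 'I_n -> 'rV[R]_d -> R).
Hypothesis f_diff : forall i x, differentiable (f i) x.
Implicit Types (A : {set 'I_n}) (x y : 'rV[R]_d).

Lemma grad_fbatch A x :
  grad (fbatch f tau A) x = tau%:R^-1 *: \sum_(i in A) grad (f i) x.
Proof.
apply/rowP => j; rewrite !mxE summxE.
(* Padding by zero outside [A] gives a sum over all indices, to which the derivative rule for sums
   applies. *)
pose h (i : 'I_n) : 'rV[R]_d -> R := if i \in A then f i else cst 0.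
pose dh (i : 'I_n) : R := if i \in A then grad (f i) x 0 j else 0.
have -> : fbatch f tau A = tau%:R^-1 \*: (\sum_(i < n) h i).
  apply/funext => z; rewrite /fbatch /= fct_sumE big_mkcond.
  by congr (_ * _); apply: eq_bigr => i _; rewrite /h; case: ifP.
have hd i : is_derive x (delta_mx 0 j) (h i) (dh i).
  rewrite /h /dh; case: ifP => _; last exact: is_derive_cst.
  by rewrite mxE; apply/derivableP; exact: diff_derivable.
have /@derive_val -> := is_deriveZ tau%:R^-1 (is_derive_sum hd).
by rewrite [in RHS]big_mkcond.
Qed.

Lemma fbatch_convex_le A x y :
  (forall i, @convex_function R 'rV[R]_d setT (f i)) ->
  fbatch f tau A x + dotp (grad (fbatch f tau A) x) (y - x)
    <= fbatch f tau A y.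
Proof.
move=> f_convex; rewrite grad_fbatch dotpZl dotp_suml -mulrDr -big_split /=.
rewrite ler_wpM2l ?invr_ge0 //; apply: ler_sum => i _.
exact: convex_grad_le.
Qed.

Lemma fbatch_descent_le A (L : R) x y : (0 < tau)%N -> #|A| = tau ->
  (forall i, smooth L (f i)) ->
  fbatch f tau A y <= fbatch f tau A x
    + dotp (grad (fbatch f tau A) x) (y - x) + L / 2 * dotp (y - x) (y - x).
Proof.
move=> tau_gt0 cardA f_smooth.
rewrite grad_fbatch dotpZl dotp_suml -mulrDr -big_split /=.
set c := L / 2 * _.
(* Since [A] has exactly [tau] elements, the quadratic term is its own batch average. *)
have -> : c = tau%:R^-1 * \sum_(i in A) c.
  by rewrite sumr_const cardA -[c *+ _]mulr_natl mulKf // pnatr_eq0 -lt0n.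
rewrite -mulrDr -big_split ler_wpM2l ?invr_ge0 //; apply: ler_sum => i _.
exact: descent_le.
Qed.

End minibatch.

(** Jensen's inequality from the tangent plane at the mean: deviations from the mean sum to zero, so
    the linear terms cancel. *)
Lemma favg_mean_le (R : realType) (d n : nat) (f : 'I_n -> 'rV[R]_d -> R)
    (T : nat) (x : 'I_T -> 'rV[R]_d) : (0 < T)%N ->
  (forall i z, differentiable (f i) z) ->
  (forall i, @convex_function R 'rV[R]_d setT (f i)) ->
  favg f (T%:R^-1 *: \sum_(t < T) x t) <= T%:R^-1 * \sum_(t < T) favg f (x t).
Proof.
move=> T_gt0 f_diff f_convex; set xbar := _ *: _.
have T_neq0 : T%:R != 0 :> R by rewrite pnatr_eq0 -lt0n.
rewrite ler_pdivlMl ?ltr0n // mulr_natl -[X in _ *+ X]card_ord -sumr_const.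
have xbarE : \sum_(t < T) x t = T%:R *: xbar by rewrite scalerA divff ?scale1r.
have -> : \sum_(t < T) favg f xbar = \sum_(t < T)
    (favg f xbar + dotp (grad (fbatch f n [set: 'I_n]) xbar) (x t - xbar)).
  rewrite big_split /= -dotp_sumr sumrB xbarE !sumr_const card_ord.
  by rewrite scaler_nat subrr dotpC dotp0l addr0.
by apply: ler_sum => t _; rewrite !favgE fbatch_convex_le.
Qed.

Lemma smoothW (R : realType) (d : nat) (g : 'rV[R]_d -> R) (L L' : R) :
  L <= L' -> smooth L g -> smooth L' g.
Proof.
move=> LL' sg x y; apply: le_trans (sg x y) _.
by rewrite ler_wpM2r ?enorm_ge0.
Qed.

(** * The uniform law on batches of size [tau], as weights on all subsets *)

Definition minibatch_prob (R : realType) (n tau : nat) (A : {set 'I_n}) : R :=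
  if #|A| == tau then 'C(n, tau)%:R^-1 else 0.

Section sampling.
Local Open Scope set_scope.
Context (R : realType) (n tau : nat).
Hypothesis (tau_gt0 : (0 < tau)%N) (tau_le_n : (tau <= n)%N).
Local Notation p := (@minibatch_prob R n tau).

Lemma minibatch_prob_ge0 A : 0 <= p A.
Proof. by rewrite /minibatch_prob; case: ifP; rewrite ?invr_ge0. Qed.

Lemma minibatch_prob_sum (F : {set 'I_n} -> R) :
  \sum_A p A * F A = 'C(n, tau)%:R^-1 * \sum_(A : {set 'I_n} | #|A| == tau) F A.
Proof.
rewrite mulr_sumr [RHS]big_mkcond; apply: eq_bigr => A _.
by rewrite /minibatch_prob; case: ifP => // _; rewrite mul0r.
Qed.

Lemma minibatch_prob_sum1 : \sum_A p A = 1.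
Proof.
under eq_bigr do rewrite -[p _]mulr1.
rewrite minibatch_prob_sum sumr_const -cardsE card_draws card_ord.
by rewrite -[1 *+ _]/(_%:R) mulVf // pnatr_eq0 -lt0n bin_gt0.
Qed.

(* Pascal's rule: remove the draws that avoid i from all draws. *)
Lemma card_draws_mem (i : 'I_n) :
  #|[set A : {set 'I_n} | (#|A| == tau) && (i \in A)]| = 'C(n.-1, tau.-1).
Proof.
have := cardsID [set A : {set 'I_n} | i \in A]
  [set A : {set 'I_n} | #|A| == tau].
rewrite card_draws card_ord.
have -> : [set A : {set 'I_n} | #|A| == tau] :&: [set A : {set 'I_n} | i \in A]
    = [set A : {set 'I_n} | (#|A| == tau) && (i \in A)].
  by apply/setP => A; rewrite !inE.
have -> : [set A : {set 'I_n} | #|A| == tau] :\: [set A : {set 'I_n} | i \in A]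
    = [set A : {set 'I_n} | (A \subset ~: [set i]) && (#|A| == tau)].
  by apply/setP => A; rewrite !inE finset.subsetC finset.sub1set inE.
rewrite cards_draws cardsC1 card_ord.
have -> : 'C(n, tau) = ('C(n.-1, tau.-1) + 'C(n.-1, tau))%N.
  rewrite -{1 3}(prednK tau_gt0) -[n in LHS](@prednK n) ?binS 1?addnC //.
  exact: leq_trans tau_le_n.
by move/addIn.
Qed.

(** Unbiasedness: after exchanging the sums, each index is counted ['C(n.-1, tau.-1)] times, and
    [n * 'C(n.-1, tau.-1) = tau * 'C(n, tau)]. *)
Lemma minibatch_prob_fbatch (d : nat) (f : 'I_n -> 'rV[R]_d -> R) x :
  \sum_A p A * fbatch f tau A x = favg f x.
Proof.
rewrite minibatch_prob_sum /fbatch -mulr_sumr /favg.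
rewrite (exchange_big_dep xpredT) //=.
under eq_bigr => i _.
  rewrite sumr_const -cardsE.
  rewrite card_draws_mem -mulr_natl.
  over.
rewrite -mulr_sumr !mulrA; congr (_ * _).
have n_gt0 : (0 < n)%N by exact: leq_trans tau_le_n.
have C_neq0 : 'C(n, tau)%:R != 0 :> R by rewrite pnatr_eq0 -lt0n bin_gt0.
have tau_neq0 : tau%:R != 0 :> R by rewrite pnatr_eq0 -lt0n.
have n_neq0 : n%:R != 0 :> R by rewrite pnatr_eq0 -lt0n.
have : (n%:R * 'C(n.-1, tau.-1)%:R = tau%:R * 'C(n, tau)%:R :> R).
  by rewrite -!natrM mul_bin_diag prednK.
move=> bin_diag; apply: (mulfI n_neq0); rewrite divff //.
rewrite mulrCA bin_diag; field.
by rewrite tau_neq0 C_neq0.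
Qed.

End sampling.

(** * Finite-valued random variables and the product law of tuples *)

Lemma sum_tuple_cons (R : realType) (U : finType) (T : nat) (F : seq U -> R) :
  \sum_(s : T.+1.-tuple U) F s = \sum_x \sum_(s : T.-tuple U) F (x :: s).
Proof.
rewrite pair_big /= (reindex (fun q : U * T.-tuple U => [tuple of q.1 :: q.2])).
  by [].
exists (fun s : T.+1.-tuple U => (thead s, [tuple of behead s]))
  => [[x s] _|s _].
  by congr pair; apply/val_inj.
by rewrite -tuple_eta.
Qed.

Section finite_valued.
Context (R : realType) (disp : measure_display) (Omega : measurableType disp).
Context (P : probability Omega R) (U : finType).

(** [G \o X] is a finite combination of indicators of the fibres of [X], each integrating to its
    probability. *)
Lemma expectation_finite_valued (X : Omega -> U) (G : U -> R) (q : U -> R) :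
  (forall u, measurable (X @^-1` [set u])) ->
  (forall u, P (X @^-1` [set u]) = (q u)%:E) ->
  ('E_P[fun w => G (X w)] = (\sum_u q u * G u)%R%:E)%E.
Proof.
move=> mX PX; rewrite unlock.
under eq_integral => w _.
  rewrite (_ : (G (X w))%:E
      = \sum_u (G u)%:E * (\1_(X @^-1` [set u]) w)%:E)%E; last first.
    rewrite (bigD1 (X w)) //= big1 ?adde0 => [|u /eqP uX].
      by rewrite indicE mem_set // mule1.
    by rewrite indicE memNset ?mule0 // => /esym.
  over.
have int1 u : P.-integrable setT (fun w => (\1_(X @^-1` [set u]) w)%:E).
  exact: integrable_indic.
rewrite integral_sum // => [|u]; last exact: integrableZl.
rewrite -sumEFin; apply: eq_bigr => u _.
by rewrite integralZl // integral_indic // setIT EFinM -PX muleC.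
Qed.

Lemma measurable_tuple_preimage (X : nat -> Omega -> U) (T : nat)
    (s : T.-tuple U) :
  (forall t u, measurable (X t @^-1` [set u])) ->
  measurable ((fun w => [tuple X i w | i < T]) @^-1` [set s]).
Proof.
move=> mX.
have -> : (fun w => [tuple X i w | i < T]) @^-1` [set s]
        = \bigcap_(i in [set: 'I_T]) (X i @^-1` [set tnth s i]).
  apply/seteqP; split=> [w /= <- i _|w wX]; first by rewrite /= tnth_mktuple.
  by apply/eq_from_tnth => i; rewrite tnth_mktuple; exact: wX.
by apply: fin_bigcap_measurable => // i _; exact: mX.
Qed.

Lemma iid_tuple_prob (X : nat -> Omega -> U) (q : U -> R) (T : nat)
    (s : T.-tuple U) :
  mutually_independent P X ->
  (forall t u, P (X t @^-1` [set u]) = (q u)%:E) ->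
  P ((fun w => [tuple X i w | i < T]) @^-1` [set s]) = (\prod_(u <- s) q u)%:E.
Proof.
move=> indX PX.
(* Independence is indexed by all of [nat]: [A i] is the singleton of the [i]-th entry for [i < T]
   and the full set beyond. *)
pose A (i : nat) : set U :=
  [set u | forall o : 'I_T, o = i :> nat -> u = tnth s o].
have AE (o : 'I_T) : A o = [set tnth s o].
  by apply/seteqP; split=> [u /(_ o erefl)//|u -> o' /val_inj ->].
have -> : (fun w => [tuple X i w | i < T]) @^-1` [set s]
        = \bigcap_(i in [set` iota 0 T]) (X i @^-1` A i).
  apply/seteqP; split=> [w /= ws i _ o oi|w wA /=].
    by rewrite -ws tnth_mktuple oi.
  apply/eq_from_tnth => o; rewrite tnth_mktuple.
  by apply: (wA o) => //=; rewrite mem_iota /= add0n ltn_ord.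
rewrite indX ?iota_uniq // -[T in iota 0 T]subn0 -/(index_iota 0 T) big_mkord.
rewrite big_tuple -prodEFin; apply: eq_bigr => o _.
by rewrite AE PX.
Qed.

End finite_valued.

(** * Iterates as functions of finitely many batches *)

Lemma usam_iter_eq (R : realType) (d n : nat) (f : 'I_n -> 'rV[R]_d -> R)
    (tau : nat) (ell : {set 'I_n} -> R) (rho gamma_b : R) (x0 : 'rV[R]_d)
    (S S' : nat -> {set 'I_n}) (t : nat) :
  (forall i, (i < t)%N -> S i = S' i) ->
  usam_iter f tau ell rho gamma_b x0 S t
  = usam_iter f tau ell rho gamma_b x0 S' t.
Proof.
elim: t => [|t IH] eqS; first by [].
apply: (f_equal2 (usam_step f tau ell rho gamma_b) (eqS t (ltnSn t))).
by apply: IH => i it; apply: eqS; exact: ltnW.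
Qed.

(** [usam_iter] peels off the last batch; this moves the first one into the starting point.
    [finset.set0] only pads positions past the end of the sequence. *)
Lemma usam_iter_cons (R : realType) (d n : nat) (f : 'I_n -> 'rV[R]_d -> R)
    (tau : nat) (ell : {set 'I_n} -> R) (rho gamma_b : R) (x0 : 'rV[R]_d)
    (A : {set 'I_n}) (s : seq {set 'I_n}) (t : nat) :
  usam_iter f tau ell rho gamma_b x0 (nth finset.set0 (A :: s)) t.+1
  = usam_iter f tau ell rho gamma_b (usam_step f tau ell rho gamma_b A x0)
      (nth finset.set0 s) t.
Proof.
elim: t => [|t IH]; first by [].
exact: (f_equal (usam_step f tau ell rho gamma_b (nth finset.set0 s t)) IH).
Qed.

Lemma sum_tuple_prod1 (R : realType) (U : finType) (q : U -> R) (T : nat) :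
  \sum_u q u = 1 -> \sum_(s : T.-tuple U) \prod_(u <- s) q u = 1.
Proof.
move=> q1; elim: T => [|T IH].
  rewrite (bigD1 [tuple]) //= big_nil big1 ?addr0 // => s.
  by rewrite (tuple0 s) => /eqP; case; exact/val_inj.
rewrite (sum_tuple_cons T (fun s => \prod_(u <- s) q u)) -[RHS]q1.
apply: eq_bigr => u _; under eq_bigr do rewrite big_cons.
by rewrite -mulr_sumr IH mulr1.
Qed.

(** * Averaging the descent over batches and summing over the steps *)

Section convergence.
Context (R : realType) (d n tau : nat).
Hypotheses (tau_gt0 : (0 < tau)%N) (tau_le_n : (tau <= n)%N).
Context (f : 'I_n -> 'rV[R]_d -> R) (L : R).
Hypothesis f_diff : forall i x, differentiable (f i) x.
Hypothesis f_convex : forall i, @convex_function R 'rV[R]_d setT (f i).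
Hypothesis L_gt0 : 0 < L.
Hypothesis f_smooth : forall i, smooth L (f i).
Context (xstar : 'rV[R]_d) (ell : {set 'I_n} -> R).
Hypothesis ell_lb : forall A : {set 'I_n}, #|A| = tau ->
  forall x, ell A <= fbatch f tau A x.
Context (rho gamma_b : R).
Hypotheses (rho_ge0 : 0 <= rho) (Lrho_le1 : L * rho <= 1).
Hypothesis gamma_b_gt0 : 0 < gamma_b.

Local Notation p := (@minibatch_prob R n tau).
Local Notation step := (usam_step f tau ell rho gamma_b).
Local Notation iterate := (usam_iter f tau ell rho gamma_b).
Local Notation alpha := (usam_alpha L rho gamma_b).
Local Notation noise := (\sum_A p A * (fbatch f tau A xstar - ell A)).

Lemma usam_alpha_ge0 : 0 <= alpha.
Proof.
rewrite mulr_ge0 ?sqr_ge0 // le_min (ltW gamma_b_gt0) invr_ge0.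
by rewrite mulr_ge0 // ltW.
Qed.

Lemma usam_step_descent (A : {set 'I_n}) x : #|A| = tau ->
  enorm (step A x - xstar) ^+ 2 <= enorm (x - xstar) ^+ 2
    - alpha * (fbatch f tau A x - ell A)
    + 2 * gamma_b * (fbatch f tau A xstar - ell A).
Proof.
move=> cardA; apply: polyak_descent => //.
- by move=> y z; exact: fbatch_convex_le.
- by move=> y z; exact: fbatch_descent_le.
- exact: ell_lb.
Qed.

Lemma usam_step_mean_descent x :
  alpha * (favg f x - favg f xstar)
    + \sum_A p A * enorm (step A x - xstar) ^+ 2
  <= enorm (x - xstar) ^+ 2 + (2 * gamma_b - alpha) * noise.
Proof.
have favg_sum := minibatch_prob_fbatch tau_gt0 tau_le_n f.
have p1 := minibatch_prob_sum1 R tau_le_n.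
have : \sum_A p A * enorm (step A x - xstar) ^+ 2
  <= \sum_A p A * (enorm (x - xstar) ^+ 2
    - alpha * (fbatch f tau A x - ell A)
    + 2 * gamma_b * (fbatch f tau A xstar - ell A)).
  (* [ell_lb] covers batches of size [tau]; all other subsets have weight zero. *)
  apply: ler_sum => A _; case: (eqVneq #|A| tau) => [cardA|/negPf cardA].
    by rewrite ler_wpM2l ?minibatch_prob_ge0 ?usam_step_descent.
  by rewrite /minibatch_prob cardA !mul0r.
move=> /(lerD (lexx (alpha * (favg f x - favg f xstar)))) /le_trans; apply.
(* Splitting [fbatch f tau A x - ell A] at the value at [xstar] moves [- alpha] onto the noise,
   whence the factor [2 * gamma_b - alpha]. *)
rewrite (eq_bigr (fun A => p A * enorm (x - xstar) ^+ 2
  - alpha * (p A * fbatch f tau A x) + alpha * (p A * fbatch f tau A xstar)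
  + (2 * gamma_b - alpha) * (p A * (fbatch f tau A xstar - ell A))));
  last by move=> A _; ring.
rewrite !big_split /= sumrN -!mulr_sumr -mulr_suml p1 !favg_sum.
by lra.
Qed.

(* Induction on the first batch drawn, with the starting point generalized: no
   filtration or conditional expectation is needed. *)
Lemma usam_sum_le (T : nat) x :
  alpha * (\sum_(s : T.-tuple {set 'I_n}) (\prod_(A <- s) p A) *
     \sum_(t < T) (favg f (iterate x (nth finset.set0 s) t) - favg f xstar))
  <= enorm (x - xstar) ^+ 2 + T%:R * ((2 * gamma_b - alpha) * noise).
Proof.
elim: T x => [|T IH] x.
  rewrite big1 => [|s _]; last by rewrite big_ord0 mulr0.
  by rewrite mulr0 mul0r addr0 sqr_ge0.
have p1 := minibatch_prob_sum1 R tau_le_n.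
rewrite (sum_tuple_cons T (fun s => (\prod_(A <- s) p A) *
     \sum_(t < T.+1)
       (favg f (iterate x (nth finset.set0 s) t) - favg f xstar))).
(* The term [t = 0] does not depend on the draws; the others form the same sum started at
   [step A x]. *)
rewrite (eq_bigr (fun A => p A * (favg f x - favg f xstar)
  + p A * \sum_(s : T.-tuple {set 'I_n}) (\prod_(B <- s) p B) *
     \sum_(t < T) (favg f (iterate (step A x) (nth finset.set0 s) t)
       - favg f xstar))); last first.
  move=> A _.
  have -> : favg f x - favg f xstar = \sum_(s : T.-tuple {set 'I_n})
      (\prod_(B <- s) p B) * (favg f x - favg f xstar).
    by rewrite -mulr_suml sum_tuple_prod1 // mul1r.
  rewrite -mulrDr -big_split /= mulr_sumr; apply: eq_bigr => s _.
  rewrite big_cons big_ord_recl -mulrDr -mulrA; congr (_ * (_ * (_ + _))).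
  apply: eq_bigr => t _; congr (favg f _ - _).
  exact: usam_iter_cons.
rewrite big_split /= -mulr_suml p1 mul1r mulrDr mulr_sumr.
have : \sum_A alpha * (p A * \sum_(s : T.-tuple {set 'I_n})
     (\prod_(B <- s) p B) * \sum_(t < T)
       (favg f (iterate (step A x) (nth finset.set0 s) t) - favg f xstar))
  <= \sum_A p A * (enorm (step A x - xstar) ^+ 2
       + T%:R * ((2 * gamma_b - alpha) * noise)).
  (* What remains for each [A] is the induction hypothesis at [step A x]. *)
  apply: ler_sum => A _; rewrite mulrCA ler_wpM2l ?minibatch_prob_ge0 //.
move=> /(lerD (lexx (alpha * (favg f x - favg f xstar)))) /le_trans; apply.
set K := (2 * gamma_b - alpha) * noise; under eq_bigr do rewrite mulrDr.
rewrite big_split /= -mulr_suml p1 mul1r addrA.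
rewrite -[T.+1%:R]natr1 mulrDl mul1r [X in _ <= _ + X]addrC [in leRHS]addrA.
rewrite lerD2r.
exact: usam_step_mean_descent.
Qed.

Lemma usam_mean_le (T : nat) x : (0 < T)%N -> alpha != 0 ->
  \sum_(s : T.-tuple {set 'I_n}) (\prod_(A <- s) p A) *
    (favg f (usam_mean f tau ell rho gamma_b x (nth finset.set0 s) T)
      - favg f xstar)
  <= enorm (x - xstar) ^+ 2 / (alpha * T%:R)
     + (2 * gamma_b - alpha) / alpha * noise.
Proof.
move=> T_gt0 alpha_neq0.
have alpha_gt0 : 0 < alpha by rewrite lt_def alpha_neq0 usam_alpha_ge0.
have T_gt0' : 0 < T%:R :> R by rewrite ltr0n.
have T_neq0 : T%:R != 0 :> R by rewrite gt_eqF.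
(* Jensen is applied separately to each sequence [s] of batches. *)
apply: (@le_trans _ _ (T%:R^-1 * \sum_(s : T.-tuple {set 'I_n})
    (\prod_(A <- s) p A) * \sum_(t < T)
      (favg f (iterate x (nth finset.set0 s) t) - favg f xstar))).
  rewrite mulr_sumr; apply: ler_sum => s _; rewrite mulrCA ler_wpM2l //.
    by apply: prodr_ge0 => A _; exact: minibatch_prob_ge0.
  rewrite sumrB mulrBr sumr_const card_ord.
  rewrite -[favg f xstar *+ T]mulr_natl mulKf //.
  by rewrite lerD2r; exact: favg_mean_le.
rewrite ler_pdivrMl // -(ler_pM2l alpha_gt0).
apply: le_trans (usam_sum_le T x) _.
by rewrite le_eqVlt; apply/orP; left; apply/eqP; field; rewrite alpha_neq0.
Qed.

End convergence.

Theorem theorem3p8 (R : realType) (disp : measure_display)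
    (Omega : measurableType disp) (P : probability Omega R)
    (d n tau : nat) (tau_gt0 : (0 < tau)%N) (tau_le_n : (tau <= n)%N)
    (f : 'I_n -> 'rV[R]_d -> R) (L : 'I_n -> R)
    (f_diff : forall i x, differentiable (f i) x)
    (f_lb : forall i, exists m : R, forall x, m <= f i x)
    (f_convex : forall i, @convex_function R 'rV[R]_d setT (f i))
    (L_gt0 : forall i, 0 < L i)
    (f_smooth : forall i, smooth (L i) (f i))
    (xstar : 'rV[R]_d) (xstar_min : forall x, favg f xstar <= favg f x)
    (ell : {set 'I_n} -> R)
    (ell_lb : forall A : {set 'I_n}, #|A| = tau ->
       forall x, ell A <= fbatch f tau A x)
    (rho gamma_b : R) (rho_ge0 : 0 <= rho) (rho_le : rho <= (Lmax L)^-1)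
    (gamma_b_gt0 : 0 < gamma_b)
    (S : nat -> Omega -> {set 'I_n}) (S_iid : iid_minibatches P tau S)
    (x0 : 'rV[R]_d) :
  let alpha := usam_alpha (Lmax L) rho gamma_b in
  let xbar (T : nat) (w : Omega) :=
    usam_mean f tau ell rho gamma_b x0 (fun t => S t w) T in
  forall T t : nat, (1 <= T)%N ->
  ('E_P[fun w => (favg f (xbar T w) - favg f xstar)%R]
   <= if alpha == 0%R then +oo
      else (enorm (x0 - xstar) ^+ 2 / (alpha * T%:R))%:E
           + ((2 * gamma_b - alpha) / alpha)%:E
             * sigma2 P f tau ell xstar (S t))%E.
Proof.
move=> alpha xbar T t T_gt0; case: eqVneq => [_|alpha_neq0]; first exact: leey.
have [mS indS S_prob] := S_iid.
have Lmax_ge i : L i <= Lmax L by exact: (le_bigmax 0 L i).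
have Lmax_gt0 : 0 < Lmax L.
  (* A nonempty index set supplies some positive [L i] below the maximum. *)
  have n_gt0 : (0 < n)%N by exact: leq_trans tau_le_n.
  exact: lt_le_trans (L_gt0 (Ordinal n_gt0)) (Lmax_ge _).
have Lrho_le1 : Lmax L * rho <= 1 by rewrite -ler_pdivlMl // mulr1.
have smooth_Lmax i : smooth (Lmax L) (f i) by exact: smoothW (f_smooth i).
have -> : sigma2 P f tau ell xstar (S t) = (\sum_A minibatch_prob R tau A
    * (fbatch f tau A xstar - ell A))%R%:E.
  apply: (expectation_finite_valued (X := S t)
    (fun A => fbatch f tau A xstar - ell A)) => A; first exact: mS.
  exact: S_prob.
(* The mean iterate depends on the first [T] draws alone, so it factors through a random variable
   with finitely many values. *)
pose X w : T.-tuple {set 'I_n} := [tuple S i w | i < T].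
pose G (s : T.-tuple {set 'I_n}) : R :=
  favg f (usam_mean f tau ell rho gamma_b x0 (nth finset.set0 s) T)
  - favg f xstar.
have -> : (fun w => favg f (xbar T w) - favg f xstar)
  = (fun w => G (X w)).
  apply/funext => w; congr (favg f (_ *: _) - _); apply: eq_bigr => j _.
  (* Iterate [j < T] reads only batches of index below [j], so the padding of [nth] is never met. *)
  apply: usam_iter_eq => i ij; have iT := ltn_trans ij (ltn_ord j).
  by rewrite -(tnth_nth _ _ (Ordinal iT)) tnth_mktuple.
(* Independence gives the tuple product weights, which turns the expectation into the sum bounded by
   [usam_mean_le]. *)
rewrite (@expectation_finite_valued _ _ _ _ _ X G
  (fun s => \prod_(A <- s) minibatch_prob R tau A)).
- by rewrite -EFinM -EFinD lee_fin usam_mean_le.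
- by move=> s; apply: measurable_tuple_preimage => i A; exact: mS.
- by move=> s; exact: iid_tuple_prob.
Qed.
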